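(* Let $F\subset\mathbb{R}^d$ be the attractor of an autonomous iterated function system of contracting similarities $\{f_i\}_{i\in\mathcal{I}}$ on $\mathbb{R}^d$. If the system satisfies the Moran open-set condition, then $F$ is equi-homogeneous.
   Context: An autonomous iterated function system of similarities is a finite family $\{f_i\}_{i\in\mathcal I}$ of maps $f_i:\mathbb{R}^d\to\mathbb{R}^d$ with $|f_i(x)-f_i(y)|=\sigma_i|x-y|$ for all $x,y$, where $\sigma_i\in(0,1)$. Its attractor is the unique non-empty compact set $F$ with $F=\bigcup_{i\in\mathcal I}f_i(F)$. Moran open-set condition: there exists an open set $U\subset\mathbb{R}^d$ such that $F\subset\overline U$, $f_i(U)\subseteq U$ for all $i\in\mathcal I$, and $f_i(U)\cap f_j(U)=\emptyset$ for $i\ne j$. For a subset $A$ of a metric space and $\delta>0$, $B_\delta(x)$ is the closed ball of radius $\delta$ and centre $x$, and $\mathcal{N}(A,\delta)$ is the minimum number of closed balls of radius $\delta$ with centres in $A$ whose union contains $A$. A subset $F$ of a metric space is equi-homogeneous if for all $\delta_0>0$ there exist constants $M\ge 1$ and $c_1,c_2>0$ such that $\sup_{x\in F}\mathcal{N}(B_\delta(x)\cap F,\rho)\le M\inf_{x\in F}\mathcal{N}(B_{c_1\delta}(x)\cap F,c_2\rho)$ for all $\delta,\rho$ with $0<\rho<\delta\le\delta_0$. *)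

(* Defs.v *)
From HB Require Import structures.
From mathcomp Require Import all_boot all_order all_algebra.
From mathcomp Require Import all_classical all_reals all_analysis.
From mathcomp Require Import ring lra.

Set Implicit Arguments.
Unset Strict Implicit.
Unset Printing Implicit Defensive.

Import Order.TTheory GRing.Theory Num.Theory.

Local Open Scope classical_set_scope.
Local Open Scope ring_scope.

(* The library norm and pseudometric on row vectors are those of the maximum
   norm. Hence an alias, whose only metric, and whose topology, is the one of
   the Euclidean distance. *)
Definition euclidean (R : realType) (d : nat) : Type := 'rV[R]_d.

HB.instance Definition _ (R : realType) (d : nat) :=
  Choice.copy (euclidean R d) 'rV[R]_d.

Definition eucl_dist (R : realType) (d : nat) (x y : euclidean R d) : R :=
  Num.sqrt (\sum_(i < d) ((x : 'rV[R]_d) 0 i - (y : 'rV[R]_d) 0 i) ^+ 2).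

Section euclidean_metric.
Context (R : realType) (d : nat).
Implicit Types x y z : euclidean R d.

Let cauchy_schwarz (a b : 'I_d -> R) :
  (\sum_i a i * b i) ^+ 2 <= (\sum_i a i ^+ 2) * (\sum_i b i ^+ 2).
Proof.
set A := \sum_i a i ^+ 2; set B := \sum_i b i ^+ 2.
set C := \sum_i a i * b i.
have B0 : 0 <= B by apply: sumr_ge0 => i _; exact: sqr_ge0.
have pos t : 0 <= A - t * C *+ 2 + t ^+ 2 * B.
  have -> : A - t * C *+ 2 + t ^+ 2 * B = \sum_i (a i - t * b i) ^+ 2.
    rewrite /A /B /C !mulr_sumr -sumrMnl -sumrB -big_split /=.
    by apply: eq_bigr => i _; ring.
  by apply: sumr_ge0 => i _; exact: sqr_ge0.
have [B_eq0|B_neq0] := eqVneq B 0.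
  suff -> : C = 0 by rewrite B_eq0 mulr0 expr0n.
  have b0 i : b i = 0.
    move/eqP: B_eq0; rewrite psumr_eq0; last by move=> j _; exact: sqr_ge0.
    by move=> /allP/(_ i (mem_index_enum i)) /=; rewrite sqrf_eq0 => /eqP.
  by rewrite /C big1// => i _; rewrite b0 mulr0.
have Bgt0 : 0 < B by rewrite lt_neqAle eq_sym B_neq0.
have := pos (C / B).
have -> : A - C / B * C *+ 2 + (C / B) ^+ 2 * B = (A * B - C ^+ 2) / B.
  by field.
by rewrite pmulr_lge0 ?invr_gt0// subr_ge0.
Qed.

Let eucl_distxx x : eucl_dist x x = 0.
Proof.
by rewrite /eucl_dist big1 ?sqrtr0// => i _; rewrite subrr expr0n.
Qed.

Let eucl_dist_positivity x y : eucl_dist x y = 0 -> x = y.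
Proof.
move=> /eqP; rewrite sqrtr_eq0 => le0; apply/rowP => i; apply/eqP.
have /eqP : \sum_(i < d) ((x : 'rV[R]_d) 0 i - (y : 'rV[R]_d) 0 i) ^+ 2 = 0.
  by apply/eqP; rewrite eq_le le0 sumr_ge0// => j _; exact: sqr_ge0.
rewrite psumr_eq0; last by move=> j _; exact: sqr_ge0.
by move=> /allP/(_ i (mem_index_enum i)) /=; rewrite sqrf_eq0 subr_eq0.
Qed.

Let eucl_dist_sym x y : eucl_dist x y = eucl_dist y x.
Proof. by congr Num.sqrt; apply: eq_bigr => i _; rewrite -sqrrN opprB. Qed.

Let eucl_dist_triangle y x z : eucl_dist x z <= eucl_dist x y + eucl_dist y z.
Proof.
pose a i := (x : 'rV[R]_d) 0 i - (y : 'rV[R]_d) 0 i.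
pose b i := (y : 'rV[R]_d) 0 i - (z : 'rV[R]_d) 0 i.
have sq_ge0 (u : 'I_d -> R) : 0 <= \sum_i u i ^+ 2.
  by apply: sumr_ge0 => i _; exact: sqr_ge0.
have s0 : 0 <= eucl_dist x y + eucl_dist y z by rewrite addr_ge0// sqrtr_ge0.
rewrite -(ger0_norm s0) -sqrtr_sqr ler_wsqrtr// sqrrD.
rewrite !sqr_sqrtr ?(sq_ge0 a) ?(sq_ge0 b)// -/(a _) -/(b _).
have -> : \sum_(i < d) ((x : 'rV[R]_d) 0 i - (z : 'rV[R]_d) 0 i) ^+ 2 =
    \sum_i a i ^+ 2 + (\sum_i a i * b i) *+ 2 + \sum_i b i ^+ 2.
  rewrite -sumrMnl -!big_split /=; apply: eq_bigr => i _.
  by rewrite /a /b; ring.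
rewrite lerD2r lerD2l lerMn2r /= -sqrtrM ?(sq_ge0 a)//.
by rewrite (le_trans (ler_norm _))// -sqrtr_sqr ler_wsqrtr// cauchy_schwarz.
Qed.

HB.instance Definition _ := @isMetric.Build R (euclidean R d)
  (@eucl_dist R d) eucl_distxx eucl_dist_positivity eucl_dist_sym eucl_dist_triangle.

End euclidean_metric.

(* In a general metric space the library's [closed_ball], the closure of the
   open ball, can be smaller than this set. *)
Definition cball (R : realType) (X : metricType R) (x : X) (delta : R) : set X :=
  [set y | mdist x y <= delta].

Definition ball_cover (R : realType) (X : metricType R) (A : set X) (delta : R)
    (s : seq X) : Prop :=
  [set` s] `<=` A /\ A `<=` \bigcup_(x in [set` s]) cball x delta.

(* The infimum of a set of natural numbers: a minimum, unless A has no finite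
   cover, when it is +oo. *)
Definition covering_number (R : realType) (X : metricType R) (A : set X)
    (delta : R) : \bar R :=
  ereal_inf [set (size s)%:R%:E | s in ball_cover A delta].

Definition equi_homogeneous (R : realType) (X : metricType R) (F : set X) :=
  forall delta0 : R, 0 < delta0 ->
  exists M c1 c2 : R, [/\ 1 <= M, 0 < c1, 0 < c2 &
    forall delta rho : R, 0 < rho -> rho < delta -> delta <= delta0 ->
      (ereal_sup [set covering_number (cball x delta `&` F) rho | x in F] <=
       M%:E * ereal_inf
         [set covering_number (cball x (c1 * delta) `&` F) (c2 * rho) | x in F])%E].

Definition contracting_similarity (R : realType) (X : metricType R)
    (f : X -> X) : Prop :=
  exists sigma : R, [/\ 0 < sigma, sigma < 1 &
    forall x y, mdist (f x) (f y) = sigma * mdist x y].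

Definition is_attractor (T : topologicalType) (I : finType) (f : I -> T -> T)
    (F : set T) : Prop :=
  [/\ F !=set0, compact F & F = \bigcup_i (f i @` F)].

Definition moran_open_set_condition (T : topologicalType) (I : finType)
    (f : I -> T -> T) (F : set T) : Prop :=
  exists U : set T, [/\ open U, F `<=` closure U,
    forall i, f i @` U `<=` U &
    forall i j, i != j -> f i @` U `&` f j @` U = set0].

(* Main.v *)
(* At scale [delta] cut the attractor F into the finitely many pieces g_j(F),
   with g_j a composition of maps of the system whose ratio is comparable to
   [delta]. A piece containing y lies in B_delta(y), so a cover of
   B_delta(y) /\ F covers that piece, and the maps g_j g_k^-1 carry this cover
   to every other piece with a bounded loss in the radius. It remains to bound
   the number of pieces meeting B_delta(x): the open-set condition places
   disjoint balls of radius comparable to [delta] near these pieces. Similarities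
   of R^d are onto, so the image of a ball is a ball; the points g_j(u), for a
   fixed u in U, are thus separated, and a packing bound applies. *)

Require Import Defs.
From mathcomp Require Import all_boot all_order all_algebra.
From mathcomp Require Import all_classical all_reals all_analysis.
From mathcomp Require Import ring lra.

Set Implicit Arguments.
Unset Strict Implicit.
Unset Printing Implicit Defensive.

Import Order.TTheory GRing.Theory Num.Theory.

Local Open Scope classical_set_scope.
Local Open Scope ring_scope.

(** * Covering numbers in a metric space *)

Section covers.
Context (R : realType) (X : metricType R).
Implicit Types (A B : set X) (r : R) (s : seq X).

Lemma compact_mdist_bounded A (u : X) :
  compact A -> exists D, forall z, A z -> mdist u z <= D.
Proof.
move=> /compact_near_coveringP coverA.
have [|D [_ DA]] := coverA R +oo (fun D z => mdist u z <= D) _.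
  move=> x _; exists (ball x 1, [set D | mdist u x + 1 < D]); first split => /=.
  - exact: nbhsx_ballx.
  - exact/nbhs_pinfty_gt/num_real.
  - move=> [z D] /= []; rewrite ballEmdist /= => xz uD.
    by rewrite (le_trans (metric_triangle _ x _))// ltW// (lt_trans _ uD)// ltrD2l.
by exists (D + 1); apply: DA; rewrite ltrDl ltr01.
Qed.

(** A ball of radius [r] that meets [A] at [q] lies in the ball of radius [2r] about [q]; a ball
    that misses [A] is dropped. *)
Lemma recentre_cover A r s :
  A `<=` \bigcup_(x in [set` s]) cball x r ->
  exists s', (size s' <= size s)%N /\ ball_cover A (r *+ 2) s'.
Proof.
move=> As.
(* Intersecting with [A] makes the claim inductive: the tail of [s] may fail to cover [A]. *)
suff [s' [ss' s'A s's]] : exists s', [/\ (size s' <= size s)%N, [set` s'] `<=` A &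
    A `&` \bigcup_(x in [set` s]) cball x r `<=`
    \bigcup_(x in [set` s']) cball x (r *+ 2)].
  exists s'; split=> //; split=> // a Aa; apply: s's; split => //; exact: As.
elim: s {As} => [|p s [s' [ss' s'A s's]]].
  by exists [::]; split => // a [_ [x]].
have [[q [Aq pq]]|noq] := pselect (exists q, A q /\ cball p r q).
  exists (q :: s'); split => //=.
    by move=> y /=; rewrite inE => /orP[/eqP ->//|]; exact: s'A.
  move=> a [Aa [x /=]]; rewrite inE => /orP[/eqP -> pa|xs xa].
    exists q; rewrite /= ?mem_head// /cball/= (le_trans (metric_triangle _ p _))//.
    by rewrite mulr2n lerD// metric_sym.
  have [|y ys' ya] := s's a; first by split => //; exists x.
  by exists y => //=; rewrite inE ys' orbT.
exists s'; split => //=; first exact: leqW.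
move=> a [Aa [x /=]]; rewrite inE => /orP[/eqP -> pa|xs xa].
  by case: noq; exists a.
by apply: s's; split => //; exists x.
Qed.

Lemma covering_number_le_mul A B r r' (K : nat) : (0 < K)%N ->
  (forall s, ball_cover B r' s ->
    exists s', (size s' <= K * size s)%N /\ ball_cover A r s') ->
  (covering_number A r <= K%:R%:E * covering_number B r')%E.
Proof.
move=> K0 H; have KR : (0 : R) < K%:R by rewrite ltr0n.
rewrite -lee_pdivrMl//; apply: le_ereal_inf_tmp => _ [s Bs <-].
rewrite lee_pdivrMl//; have [s' [ss' As']] := H _ Bs.
apply: (@le_trans _ _ (size s')%:R%:E); first by apply: ereal_inf_lbound; exists s'.
by rewrite -EFinM lee_fin -natrM ler_nat.
Qed.

Lemma sup_covering_number_le (F : set X) (a b : X -> set X) r r' (K : nat) :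
  (0 < K)%N ->
  (forall x y, F x -> F y ->
    covering_number (a x) r <= K%:R%:E * covering_number (b y) r')%E ->
  (ereal_sup [set covering_number (a x) r | x in F] <=
   K%:R%:E * ereal_inf [set covering_number (b x) r' | x in F])%E.
Proof.
move=> K0 H; have KR : (0 : R) < K%:R by rewrite ltr0n.
apply: ge_ereal_sup => _ [x Fx <-]; rewrite -lee_pdivrMl//.
by apply: le_ereal_inf_tmp => _ [y Fy <-]; rewrite lee_pdivrMl//; exact: H.
Qed.

End covers.

(** * Surjectivity of similarities and packing in Euclidean space *)

Section euclidean_space.
Context (R : realType) (d : nat).
Implicit Types (x y : euclidean R d) (u v : 'rV[R]_d).

Lemma eucl_coord_le x y (i : 'I_d) :
  `|(x : 'rV[R]_d) 0 i - (y : 'rV[R]_d) 0 i| <= mdist x y.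
Proof.
rewrite -sqrtr_sqr ler_wsqrtr// (bigD1 i)//= lerDl.
by apply: sumr_ge0 => j _; exact: sqr_ge0.
Qed.

(** The factor [d + 1] stands in for the square root of [d]; as [d < (d + 1)^2], the bound is strict
    even for [d = 0]. *)
Lemma eucl_mdist_lt x y (c : R) : 0 < c ->
  (forall i, `|(x : 'rV[R]_d) 0 i - (y : 'rV[R]_d) 0 i| <= c) ->
  mdist x y < d.+1%:R * c.
Proof.
move=> c0 xyc; have dc0 : 0 < d.+1%:R * c by rewrite mulr_gt0// ltr0n.
rewrite -(gtr0_norm dc0) -sqrtr_sqr ltr_sqrt ?exprn_gt0//.
apply: (@le_lt_trans _ _ (\sum_(i < d) c ^+ 2)).
  apply: ler_sum => i _; rewrite -real_normK ?num_real//.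
  by rewrite lerXn2r// ?nnegrE// ltW.
rewrite sumr_const card_ord -[_ *+ d]mulr_natl exprMn ltr_pM2r ?exprn_gt0//.
by rewrite -natrX ltr_nat expnS expn1 leq_pmulr.
Qed.

Let dot u v : R := \sum_i u 0 i * v 0 i.

(** Polarisation: a distance-preserving map that fixes the origin preserves dot products. *)
Let dot_polar u v : dot u v = (dot u u + dot v v - dot (u - v) (u - v)) / 2.
Proof.
rewrite /dot -big_split -sumrB mulr_suml; apply: eq_bigr => i _ /=.
by rewrite !mxE; field.
Qed.

Let mdist_dot x y : mdist x y ^+ 2 = dot ((x : 'rV[R]_d) - y) ((x : 'rV[R]_d) - y).
Proof.
rewrite /mdist /= /eucl_dist sqr_sqrtr; last first.
  by apply: sumr_ge0 => i _; exact: sqr_ge0.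
by apply: eq_bigr => i _; rewrite !mxE expr2.
Qed.

(* Normalised to fix the origin, a similarity preserves dot products, so it is
   the inverse of right multiplication by [A^T], where the rows of [A] are the
   images of the standard basis. *)
Lemma similarity_surj (f : euclidean R d -> euclidean R d) (sigma : R) :
  0 < sigma -> (forall x y, mdist (f x) (f y) = sigma * mdist x y) ->
  forall y, exists x, f x = y.
Proof.
move=> sigma0 fsim y; have sN0 := lt0r_neq0 sigma0.
pose h u : 'rV[R]_d := sigma^-1 *: ((f u : 'rV[R]_d) - f (0 : 'rV[R]_d)).
have h0 : h 0 = 0 by rewrite /h subrr scaler0.
have hB u v : dot (h u - h v) (h u - h v) = dot (u - v) (u - v).
  rewrite -scalerBr opprB addrA subrK.
  have -> w : dot (sigma^-1 *: w) (sigma^-1 *: w) = sigma ^- 2 * dot w w.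
    by rewrite /dot mulr_sumr; apply: eq_bigr => i _; rewrite !mxE; field.
  by rewrite -!mdist_dot fsim exprMn mulKf// expf_neq0.
have hd u v : dot (h u) (h v) = dot u v.
  rewrite dot_polar [RHS]dot_polar hB; congr ((_ + _ - _) / 2).
    by rewrite -{1 2}[h u]subr0 -{1 2}h0 hB subr0.
  by rewrite -{1 2}[h v]subr0 -{1 2}h0 hB subr0.
pose A : 'M[R]_d := \matrix_i h (delta_mx 0 i).
have hA u : h u *m A^T = u.
  apply/rowP => j; rewrite mxE.
  transitivity (dot (h u) (h (delta_mx 0 j))).
    by apply: eq_bigr => k _; rewrite [A^T k j]mxE [A j k]mxE.
  rewrite hd /dot (bigD1 j)//= big1.
    by rewrite mxE !eqxx mulr1 addr0.
  by move=> k /negPf kj; rewrite mxE kj mulr0.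
(* By [hA] the rows of [A A^T] are the standard basis, and a one-sided inverse of a square matrix is
   two-sided. *)
have AtA : A^T *m A = 1%:M.
  apply: mulmx1C; apply/row_matrixP => i.
  by rewrite row_mul rowK hA rowE mulmx1.
pose w := sigma^-1 *: ((y : 'rV[R]_d) - f (0 : 'rV[R]_d)).
exists (w *m A^T); have : h (w *m A^T) = w.
  by rewrite -[LHS]mulmx1 -AtA mulmxA hA -mulmxA AtA mulmx1.
by move/(scalerI (invr_neq0 sN0))/addIr.
Qed.

(* Pigeonhole on the cells of a cubic grid of mesh [eta / (d + 1)]. *)
Lemma separated_card (J : finType) (S : {set J}) (p : J -> euclidean R d) x
    (a eta : R) : 0 < eta ->
  (forall j, j \in S -> mdist x (p j) <= a) ->
  (forall j k, j != k -> eta <= mdist (p j) (p k)) ->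
  (#|S| <= (Num.truncn (2 * a * d.+1%:R / eta)).+1 ^ d)%N.
Proof.
move=> eta0 pa psep; set N := Num.truncn _; set c := eta / d.+1%:R.
have c0 : 0 < c by rewrite divr_gt0// ltr0n.
(* For [j] in [S] the shift by [a] gives [0 <= z j i <= 2a / c], so [N + 1] cells per axis
   suffice. *)
pose z j i := ((p j : 'rV[R]_d) 0 i - (x : 'rV[R]_d) 0 i + a) / c.
pose cell j : {ffun 'I_d -> 'I_N.+1} := [ffun i => inord (Num.truncn (z j i))].
have z_bound j i : j \in S -> 0 <= z j i /\ (Num.truncn (z j i) < N.+1)%N.
  move=> jS; have := le_trans (eucl_coord_le x (p j) i) (pa _ jS).
  rewrite distrC ler_norml => /andP[lo hi].
  have z0 : 0 <= z j i by rewrite divr_ge0// ?(ltW c0)//; lra.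
  split=> //; rewrite ltnS truncn_le_nat.
  apply: le_lt_trans (truncnS_gt _); rewrite /z /c invf_div mulrA ler_pM2r ?invr_gt0//.
  by rewrite ler_pM2r ?ltr0n//; lra.
rewrite -[leqRHS](_ : #|{ffun 'I_d -> 'I_N.+1}| = _); last first.
  by rewrite card_ffun !card_ord.
rewrite -(@card_in_imset _ _ cell); first exact: max_card.
(* Points in one cell differ by at most [c] in each coordinate, so their distance is less than
   [(d + 1) c = eta]. *)
move=> j k jS kS /ffunP cjk; apply/eqP/negPn/negP => /psep; apply/negP.
rewrite -ltNge; have -> : eta = d.+1%:R * c by rewrite /c mulrC divfK// pnatr_eq0.
apply: eucl_mdist_lt => // i.
have [zj0 zjN] := z_bound j i jS; have [zk0 zkN] := z_bound k i kS.
have /(congr1 (@nat_of_ord _)) := cjk i; rewrite !ffunE !inordK// => tjk.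
have /andP[] := truncn_itv zj0; have /andP[] := truncn_itv zk0.
rewrite tjk -natr1 => k1 k2 j1 j2.
have -> : (p j : 'rV[R]_d) 0 i - (p k : 'rV[R]_d) 0 i = (z j i - z k i) * c.
  by rewrite /z; field; rewrite lt0r_neq0.
rewrite normrM (gtr0_norm c0) ger_pMl// ler_norml; apply/andP; split; lra.
Qed.

End euclidean_space.

(** * Refinement of the system to a given scale *)

Definition moran_system (R : realType) (X : metricType R) (I : finType)
    (sigma : I -> R) (f : I -> X -> X) (F U : set X) : Prop :=
  [/\ forall i, 0 < sigma i,
      forall i x y, mdist (f i x) (f i y) = sigma i * mdist x y,
      F = \bigcup_i (f i @` F),
      forall i, f i @` U `<=` U &
      forall i j, i != j -> f i @` U `&` f j @` U = set0].

(* The maps [g j] are the compositions along the words [j] whose ratio is the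
   first along the word to satisfy [s j * D <= t]. *)
Lemma moran_refinement (R : realType) (X : metricType R) (I : finType)
    (sigma : I -> R) (f : I -> X -> X) (F U : set X) (m tau D : R) :
  moran_system sigma f F U -> 0 <= tau -> 0 <= D ->
  (forall i, m <= sigma i) -> (forall i, sigma i <= tau) ->
  forall n (t : R), 0 < t -> m * t <= D -> D * tau ^+ n <= t ->
  exists (J : finType) (s : J -> R) (g : J -> X -> X),
    moran_system s g F U /\ forall j, m * t <= s j * D <= t.
Proof.
move=> [sigma0 fsim FE fU fdisj] tau0 D0 msigma sigmatau.
(* The empty word: the identity alone, of ratio 1, which [moran_system] admits. *)
have base t : m * t <= D -> D <= t -> exists (J : finType) (s : J -> R)
    (g : J -> X -> X), moran_system s g F U /\ forall j, m * t <= s j * D <= t.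
  move=> mt Dt; exists unit, (fun=> 1), (fun=> id); split; last first.
    by move=> _; rewrite mul1r mt Dt.
  split => //.
  - by move=> _ x y; rewrite mul1r.
  - by rewrite image_id; apply/seteqP; split => [x Fx|x [_ _]//]; exists tt.
  - by move=> _; rewrite image_id.
elim=> [|n IH] t t0 mt Dt; first by apply: base; rewrite // expr0 mulr1 in Dt *.
have [|tD] := leP D t; first exact: base.
(* If [t < D], the map [f i] is put in front of a refinement at scale [t / sigma i];
   [m <= sigma i <= tau] carries both hypotheses over. The sigma type packs the family for
   [choice]. *)
have step i : exists p : {J : finType & ((J -> R) * (J -> X -> X))%type},
    moran_system (projT2 p).1 (projT2 p).2 F U /\
    forall j, m * (t / sigma i) <= (projT2 p).1 j * D <= t / sigma i.
  have [| | |J [s [g Jsg]]] := IH (t / sigma i); first by rewrite divr_gt0.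
  - apply: le_trans (ltW tD).
    by rewrite mulrA ler_pdivrMr// mulrC ler_wpM2l// ltW.
  - rewrite ler_pdivlMr// (le_trans _ Dt)// exprSr mulrA ler_wpM2l//.
    by rewrite mulr_ge0// exprn_ge0.
  - by exists (existT _ J (s, g)).
have {step} [p pP] := choice step.
pose J i := projT1 (p i).
pose s i := (projT2 (p i)).1; pose g i := (projT2 (p i)).2.
have {}pP i : moran_system (@s i) (@g i) F U /\
    forall j, m * (t / sigma i) <= s i j * D <= t / sigma i by exact: pP.
exists {i : I & J i}, (fun k => sigma (tag k) * s _ (tagged k)),
  (fun k => f (tag k) \o g _ (tagged k)); split; last first.
  move=> [i j] /=; have [_ /(_ j)] := pP i.
  rewrite mulrA ler_pdivrMr// ler_pdivlMr//.
  by rewrite -[sigma i * _ * _]mulrA [sigma i * _]mulrC.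
split.
- by move=> [i j] /=; have [[s0 _ _ _ _] _] := pP i; rewrite mulr_gt0.
- move=> [i j] x y /=; have [[_ gsim _ _ _] _] := pP i.
  by rewrite fsim gsim mulrA.
- rewrite {1}FE; apply/seteqP; split => x.
    move=> [i _ [y + <-]]; have [[_ _ {1}-> _ _] _] := pP i.
    by move=> [j _ [z Fz <-]]; exists (Tagged J j) => //; exists z.
  move=> [[i j] _ [z Fz <-]]; exists i => //=; exists (g i j z) => //.
  by have [[_ _ -> _ _] _] := pP i; exists j => //; exists z.
- move=> [i j] _ [z Uz <-] /=; have [[_ _ _ gU _] _] := pP i.
  by apply: fU; exists (g i j z) => //; apply: gU; exists z.
- move=> [i j] [i' j']; have [[_ _ _ gU gdisj] _] := pP i.
  have [[_ _ _ gU' _] _] := pP i'.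
  (* Different first letters are separated by [fdisj]; for equal ones, injectivity of [f i] reduces
     to [gdisj]. *)
  have [ii'|ii' _] := eqVneq i i'; last first.
    rewrite -subset0 -(fdisj _ _ ii') => _ [[z Uz <-] [z' Uz' /= zz']].
    split; first by exists (g i j z) => //; apply: gU; exists z.
    by exists (g i' j' z') => //; apply: gU'; exists z'.
  case: _ / ii' j' {gU'} => j' jj'; rewrite -subset0 => _ [[z Uz <-] [z' Uz' /= zz']].
  have /gdisj : j != j' by apply: contra_neq jj' => ->.
  rewrite -subset0; apply; split; first by exists z.
  exists z' => //; apply: mdist_positivity; apply/eqP.
  have := mdistxx (f i (g i j z)); rewrite -{1}zz' fsim => /eqP.
  by rewrite mulf_eq0 (gt_eqF (sigma0 i)).
Qed.

(** * Counting pieces and transporting covers at scale [delta] *)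

Section moran_system_euclidean.
Context (R : realType) (d : nat) (J : finType) (s : J -> R).
Context (g : J -> euclidean R d -> euclidean R d) (F U : set (euclidean R d)).
Context (m delta D : R).
Hypothesis moran_g : moran_system s g F U.
Hypotheses (m0 : 0 < m) (delta0 : 0 < delta) (D0 : 0 < D).
Hypothesis s_delta : forall j, m * delta <= s j * D <= delta.

(* The balls [g j @` ball u r] are disjoint and of radius at least
   [m * r * delta / D]; for [j] in [S] their centres are within [2 * delta] of [x]. *)
Lemma moran_system_card_near (S : {set J}) (x u : euclidean R d) (r : R) :
  0 < r -> ball u r `<=` U -> (forall z, F z -> mdist u z <= D) ->
  (forall j, j \in S -> exists2 z, F z & mdist x (g j z) <= delta) ->
  (#|S| <= (Num.truncn (4 * D * d.+1%:R / (m * r))).+1 ^ d)%N.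
Proof.
have [s0 gsim _ gU gdisj] := moran_g.
move=> r0 urU uD Sx; pose eta := m * delta / D * r.
have eta0 : 0 < eta by rewrite mulr_gt0// divr_gt0// mulr_gt0.
have -> : 4 * D * d.+1%:R / (m * r) = 2 * (2 * delta) * d.+1%:R / eta.
  by rewrite /eta; field; rewrite !lt0r_neq0.
apply: (@separated_card _ _ _ _ (fun j => g j u) x) => // [j|j k jk].
  move=> /Sx[z Fz xz]; rewrite (le_trans (metric_triangle _ (g j z) _))//.
  rewrite mulr_natl mulr2n lerD// gsim metric_sym.
  have /andP[_] := s_delta j; apply: le_trans.
  by rewrite ler_wpM2l ?uD// ltW.
apply: (@le_trans _ _ (s j * r)).
  by rewrite (ler_wpM2r (ltW r0))// ler_pdivrMr//; have /andP[] := s_delta j.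
(* Were the centres closer, the preimage of [g k u] under [g j] would lie in [ball u r], hence in
   [U], against disjointness. *)
rewrite leNgt; apply/negP => jku.
have [z gz] := similarity_surj (s0 j) (gsim j) (g k u).
have uz : ball u r z by move: jku; rewrite -gz gsim ltr_pM2l// ballEmdist.
have : (g j @` U `&` g k @` U) (g k u).
  split; first by exists z => //; exact: urU.
  by exists u => //; apply: urU; exact: ballxx.
by rewrite gdisj.
Qed.

(** With [y] in the piece of index [k], the map [g j] after the inverse of [g k] has ratio
    [s j / s k <= 1 / m]. It turns the radius [m / 2 * r] into at most [r / 2], and recentring
    doubles this to [r]. *)
Lemma moran_system_transfer_cover (x y : euclidean R d) (r : R) (K : nat)
    (c : seq (euclidean R d)) :
  0 <= r -> (forall z z', F z -> F z' -> mdist z z' <= D) ->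
  (forall S : {set J},
    (forall j, j \in S -> exists2 z, F z & mdist x (g j z) <= delta) ->
    (#|S| <= K)%N) ->
  F y -> ball_cover (cball y delta `&` F) (m / 2 * r) c ->
  exists c', (size c' <= K * size c)%N /\ ball_cover (cball x delta `&` F) r c'.
Proof.
have [s0 gsim FE _ _] := moran_g.
move=> r0 FD SK Fy [_ yc].
have [k _ [z0 Fz0 gz0]] : (\bigcup_i (g i @` F)) y by rewrite -FE.
have gkc z : F z -> exists2 q, q \in c & mdist q (g k z) <= m / 2 * r.
  move=> Fz; have [|q /= qc qz] := yc (g k z); last by exists q.
  split; last by rewrite FE; exists k => //; exists z.
  have /andP[_ ksD] := s_delta k; rewrite /cball /= -gz0 gsim (le_trans _ ksD)//.
  by rewrite ler_wpM2l ?FD// ltW.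
have [h hK] := choice (similarity_surj (s0 k) (gsim k)).
pose S := [set j | `[< exists2 z, F z & mdist x (g j z) <= delta >]]%SET.
have sS : (#|S| <= K)%N by apply: SK => j; rewrite inE => /asboolP.
pose c1 := [seq g j (h q) | j <- enum S, q <- c].
have [|c' [c'c1 c'x]] := @recentre_cover _ _ (cball x delta `&` F) (r / 2) c1.
  move=> p [xp]; rewrite {1}FE => -[j _ [z Fz gz]].
  have [q qc qz] := gkc _ Fz; exists (g j (h q)).
    apply/allpairs_f => //; rewrite mem_enum inE; apply/asboolP.
    by exists z => //; rewrite gz.
  rewrite /cball /= -gz gsim; rewrite -{1}(hK q) gsim in qz.
  have /andP[ks _] := s_delta k; have /andP[_ js] := s_delta j.
  have jk : m * s j <= s k.
    by rewrite -(ler_pM2r D0) -mulrA (le_trans _ ks)// ler_wpM2l// ltW.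
  rewrite -(ler_pM2l m0) (le_trans (y := s k * mdist (h q) z))//.
    by rewrite mulrA ler_wpM2r// mdist_ge0.
  by rewrite (le_trans qz)// mulrA mulrAC.
exists c'; split; last by rewrite -(mulr_natr (r / 2)) divfK ?pnatr_eq0 in c'x.
by rewrite (leq_trans c'c1)// size_allpairs -cardE leq_mul2r sS orbT.
Qed.

End moran_system_euclidean.

(** * Choice of constants for the attractor, uniform in [delta] and [rho] *)

Theorem theorem1p4 (R : realType) (d : nat) (I : finType)
    (f : I -> euclidean R d -> euclidean R d) (F : set (euclidean R d)) :
  (forall i, contracting_similarity (f i)) ->
  is_attractor f F ->
  moran_open_set_condition f F ->
  equi_homogeneous F.
Proof.
move=> fcs [[x0 Fx0] cptF FE] [U [openU FU fU fdisj]] delta0 delta00.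
have [sigma sigmaP] := choice fcs.
have moran_f : moran_system sigma f F U.
  by split => // [i|i]; have [] := sigmaP i.
(* The defaults 1 and 0 give [m <= 1] and [0 <= tau] even for an empty [I]; finiteness gives [0 < m]
   and [tau < 1]. *)
pose m := \big[Num.min/1]_i sigma i; pose tau := \big[Num.max/0]_i sigma i.
have m0 : 0 < m by apply: lt_bigmin => // i _; have [] := sigmaP i.
have msigma i : m <= sigma i by exact: bigmin_le_cond.
have tau0 : 0 <= tau by exact: bigmax_ge_id.
have tau1 : tau < 1 by apply: bigmax_lt => // i _; have [] := sigmaP i.
have sigmatau i : sigma i <= tau by exact: le_bigmax_cond.
have [u Uu] : U !=set0.
  apply/set0P/eqP => U0; have := FU _ Fx0; by rewrite U0 closure0.
have [r /= r0 urU] : exists2 r : R, 0 < r & ball u r `<=` U.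
  by have /nbhs_ballP[r /= r0 urU] := open_nbhs_nbhs (conj openU Uu); exists r.
have [D1 uD1] := compact_mdist_bounded u cptF.
have D10 : 0 <= D1 := le_trans (mdist_ge0 _ _) (uD1 _ Fx0).
(* The first summand bounds the diameter of [F]; the second makes [D] positive and gives
   [m * delta <= D], which the refinement requires. *)
pose D := D1 *+ 2 + delta0.
have D0 : 0 < D by rewrite ltr_wpDl// mulrn_wge0.
have uD z : F z -> mdist u z <= D by move=> /uD1; rewrite /D; lra.
have FD z z' : F z -> F z' -> mdist z z' <= D.
  move=> /uD1 uz /uD1 uz'; rewrite (le_trans (metric_triangle _ u _))//.
  by rewrite metric_sym /D; lra.
pose K := ((Num.truncn (4 * D * d.+1%:R / (m * r))).+1 ^ d)%N.
have K0 : (0 < K)%N by rewrite expn_gt0.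
exists K%:R, 1, (m / 2); split => //; first by rewrite ler1n.
  by rewrite divr_gt0.
move=> delta rho rho0 rhodelta deltadelta0.
have delta_gt0 := lt_trans rho0 rhodelta.
have [n Dtau] : exists n, D * tau ^+ n <= delta.
  have /cvgrPdist_le/(_ (delta / D)) : tau ^+ n @[n --> \oo] --> 0.
    by apply: cvg_expr; rewrite ger0_norm.
  rewrite divr_gt0// => /(_ isT)[n _ /(_ n (leqnn n)) /=].
  rewrite sub0r normrN ger0_norm ?exprn_ge0// ler_pdivlMr// mulrC => Dn.
  by exists n.
have m1 : m <= 1 by exact: bigmin_le_id.
have [|J [s [g [moran_g s_delta]]]] := moran_refinement moran_f tau0 (ltW D0)
  msigma sigmatau delta_gt0 _ Dtau.
  by rewrite (le_trans (ler_piMl _ m1)) ?(ltW delta_gt0)// /D; lra.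
rewrite mul1r; apply: sup_covering_number_le => // x y Fx Fy.
apply: covering_number_le_mul => // c yc.
apply: (moran_system_transfer_cover moran_g m0 D0 s_delta (ltW rho0)
  FD _ Fy yc) => S Sx.
exact: (moran_system_card_near moran_g m0 delta_gt0 D0 s_delta r0 urU uD Sx).
Qed.
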